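(* Suppose $f(0)=f(u_{\max})=0$. Then the implicit finite volume scheme described in the context has a solution: for every $n\ge0$ there exist values $(u_K^{n+1})_{K\in\mathcal O}$ satisfying, for all $K\in\mathcal O$, $$m(K)\frac{u_K^{n+1}-u_K^n}{\delta t}+\sum_{L\in\mathcal N(K)}F_{K,L}(u_K^{n+1},u_L^{n+1})-\sum_{L\in\mathcal N(K)}\tau_{K|L}\big(\phi(u_L^{n+1})-\phi(u_K^{n+1})\big)=0,$$ starting from $u_K^0=\frac1{m(K)}\int_Ku_0(x)\,dx$.
   Context: Data. Let $\ell\ge1$, $\Omega\subset\mathbb R^\ell$ a bounded open set with Lipschitz boundary, $u_{\max}>0$. The function $f:[0,u_{\max}]\to\mathbb R^\ell$ is continuous. The function $\phi$ is nondecreasing and Lipschitz on $[0,u_{\max}]$, and for some $u_c\in[0,u_{\max}]$, $\phi\equiv0$ on $[0,u_c]$ and $\phi$ is strictly increasing on $[u_c,u_{\max}]$. The couple $(f,\phi)$ is non-degenerate: for every $\xi\in\mathbb R^\ell\setminus\{0\}$ the function $\lambda\mapsto\sum_{i}\xi_i f_i(\lambda)$ is not affine on any non-degenerate subinterval of $[0,u_c]$. The initial datum $u_0:\Omega\to[0,u_{\max}]$ is measurable. $\delta t>0$ is the time step. The scheme discretizes $u_t+\operatorname{div}f(u)-\Delta\phi(u)=0$ with zero-flux boundary condition. Mesh. $\mathcal O$ is a finite family of disjoint connected polygonal (polyhedral) control volumes $K\subset\Omega$ whose closures cover $\overline\Omega$, the common interface of two control volumes being contained in a hyperplane; $h=\sup_K\operatorname{diam}K$.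 For a fixed $\alpha>0$: $\alpha h^\ell\le m(K)$ and $m(\partial K)\le\frac1\alpha h^{\ell-1}$ for all $K$ (hence $|\mathcal O|\le\frac{m(\Omega)}{\alpha}h^{-\ell}$), $m$ denoting $\ell$- or $(\ell-1)$-dimensional measure. $\mathcal N(K)$ is the set of neighbours of $K$; $K|L$ is the common interface of $K$ and $L\in\mathcal N(K)$; $\bar\varepsilon_K$ is the set of all edges of $K$ (including those on $\partial\Omega$); $n_{K,\sigma}$ is the unit normal to $\sigma$ outward to $K$. The mesh is admissible: there are points $x_K\in K$ such that the line $x_Kx_L$ is orthogonal to $K|L$; $d_{K,L}=|x_K-x_L|$, $\tau_{K|L}=m(K|L)/d_{K,L}$. Numerical fluxes. For $K\in\mathcal O$, $\sigma\in\bar\varepsilon_K$, $F_{K,\sigma}:\mathbb R^2\to\mathbb R$ is continuous and: (monotone) nondecreasing in its first and nonincreasing in its second variable; (conservative) $F_{K,L}(a,b)=-F_{L,K}(b,a)$ for $\sigma=K|L$ (where $F_{K,L}=F_{K,K|L}$); (regular) Lipschitz in each variable on $[0,u_{\max}]^2$ with constant $m(\sigma)M$, $M$ fixed; (consistent) $F_{K,\sigma}(s,s)=m(\sigma)f(s)\cdot n_{K,\sigma}$ for $s\in[0,u_{\max}]$. $\phi$ is extended to $\mathbb R$ as a continuous nondecreasing function. *)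

(* Defs.v *)
From HB Require Import structures.
From mathcomp Require Import all_boot all_order all_algebra.
From mathcomp Require Import all_classical all_reals all_analysis.

Set Implicit Arguments.
Unset Strict Implicit.
Unset Printing Implicit Defensive.

Import Order.TTheory GRing.Theory Num.Theory.
Import numFieldNormedType.Exports.

Local Open Scope classical_set_scope.
Local Open Scope ring_scope.

(* The normed-module structure of 'rV[R]_l in the library carries the sup norm
   (hence the usual topology); every metric quantity below is Euclidean. *)
Section euclidean.
Context {R : realType} {l : nat}.
Implicit Types (x y : 'rV[R]_l) (A : set 'rV[R]_l).

Definition dot x y : R := \sum_(i < l) x ord0 i * y ord0 i.

Definition enorm x : R := Num.sqrt (dot x x).

Definition ediam A : \bar R :=
  ereal_sup [set (enorm (x - y))%:E | x in A & y in A].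

Definition diam A : R := fine (ediam A).

Definition box (a b : 'rV[R]_l) : set 'rV[R]_l :=
  [set x | forall i, a ord0 i <= x ord0 i <= b ord0 i].

Definition boundary A : set 'rV[R]_l := closure A `\` A°.

Definition flat A := exists (nu : 'rV[R]_l) (c : R),
  nu != 0 /\ A `<=` [set x | dot nu x = c].

(* Open polyhedral set: the interior of a finite union of finite intersections
   of closed half-spaces {x | dot h.1 x <= h.2}; it need not be convex. *)
Definition polyhedral A := exists s : seq (seq ('rV[R]_l * R)),
  A = [set x | has (all (fun h => dot h.1 x <= h.2)) s]°.

(* Near each boundary point, A is the strict epigraph of a Lipschitz function
   defined on the hyperplane orthogonal to some unit vector e. *)
Definition lipschitz_boundary A :=
  forall x, boundary A x ->
  exists (r : R) (e : 'rV[R]_l) (g : 'rV[R]_l -> R),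
    [/\ 0 < r, enorm e = 1, lipschitz g &
      forall y, enorm (y - x) < r ->
        (A y <-> g (y - dot y e *: e) < dot y e)].

End euclidean.

(* The outer measure generated by a gauge tau on all subsets; sets that may not
   occur in a covering receive the gauge +oo. *)
Section cover_measure.
Local Open Scope ereal_scope.
Context {R : realType} {T : pointedType}.
Variable tau : set T -> \bar R.

Definition cover_measure (A : set T) : \bar R :=
  ereal_inf [set \sum_(k <oo) tau (F k) |
             F in [set F : (set T)^nat | A `<=` \bigcup_k F k]].

Hypotheses (tau0 : tau set0 = 0) (tau_ge0 : forall A, 0 <= tau A).

Let U := g_sigma_algebraType [set: set T].

Let cover_measureE : cover_measure = @mu_ext _ U R tau.
Proof.
apply/funext => A; congr (ereal_inf (_ @` _)).
apply/seteqP; split => F; last by case.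
by move=> AF; split=> // k; exact: sub_sigma_algebra.
Qed.

Lemma cover_measure0 : cover_measure set0 = 0.
Proof. by rewrite cover_measureE (@mu_ext0 _ U). Qed.

Lemma cover_measure_ge0 A : 0 <= cover_measure A.
Proof. by rewrite cover_measureE; exact: (@mu_ext_ge0 _ U). Qed.

Lemma le_cover_measure : {homo cover_measure : A B / A `<=` B >-> A <= B}.
Proof. by rewrite cover_measureE; exact: (@le_mu_ext _ U). Qed.

Lemma cover_measure_sigma_subadditive : sigma_subadditive cover_measure.
Proof. by rewrite cover_measureE; exact: (@mu_ext_sigma_subadditive _ U). Qed.

End cover_measure.

Section lebesgue.
Context (R : realType) (l : nat).

(* The least volume of a box containing A (+oo when A is unbounded). *)
Definition box_gauge (A : set 'rV[R]_l) : \bar R :=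
  if A == set0 then 0%E else
  ereal_inf [set (\prod_(i < l) (ab.2 ord0 i - ab.1 ord0 i))%:E |
             ab in [set ab : 'rV[R]_l * 'rV[R]_l |
                    (forall i, ab.1 ord0 i <= ab.2 ord0 i) /\
                    A `<=` box ab.1 ab.2]].

Lemma box_gauge0 : box_gauge set0 = 0%E.
Proof. by rewrite /box_gauge eqxx. Qed.

Lemma box_gauge_ge0 A : (0 <= box_gauge A)%E.
Proof.
rewrite /box_gauge; case: ifP => // _.
apply: le_ereal_inf_tmp => _ [ab [ab_le _] <-].
by rewrite lee_fin; apply: prodr_ge0 => i _; rewrite subr_ge0.
Qed.

(* Lebesgue outer measure on R^l. *)
Definition leb : set 'rV[R]_l -> \bar R := cover_measure box_gauge.

HB.instance Definition _ := isOuterMeasure.Build R 'rV[R]_l leb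
  (cover_measure0 box_gauge0 box_gauge_ge0)
  (cover_measure_ge0 box_gauge_ge0)
  (@le_cover_measure _ _ _)
  (cover_measure_sigma_subadditive box_gauge_ge0).

Definition leb_outer : {outer_measure set 'rV[R]_l -> \bar R} := leb.

End lebesgue.

(* R^l with the sigma-algebra of Lebesgue-measurable (Caratheodory) sets, on
   which leb is a measure. *)
Notation lebType R l := (caratheodory_type (leb_outer R l)).

Definition lebesgue (R : realType) (l : nat)
    : {measure set (lebType R l) -> \bar R} :=
  (leb_outer R l : set (lebType R l) -> \bar R).

Arguments leb {R l}.
Arguments lebesgue {R l}.

(* k-dimensional Hausdorff (outer) measure on R^l, normalized by
   omega_k / 2^k (omega_k the volume of the Euclidean unit ball of R^k), so that
   it is k-dimensional Lebesgue measure on k-dimensional affine subspaces. *)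
Section hausdorff.
Context {R : realType} {l : nat}.

Definition unit_ball_volume (k : nat) : R :=
  fine (leb [set x : 'rV[R]_k | enorm x <= 1]).

(* The empty set has gauge 0 also when k = 0. *)
Definition hausdorff_gauge (k : nat) (delta : R) (A : set 'rV[R]_l) : \bar R :=
  if A == set0 then 0%E
  else if (ediam A <= delta%:E)%E
       then (unit_ball_volume k * (diam A / 2) ^+ k)%:E
       else +oo%E.

Definition hausdorff (k : nat) (A : set 'rV[R]_l) : \bar R :=
  ereal_sup [set cover_measure (hausdorff_gauge k delta) A |
             delta in [set delta | 0 < delta]].

End hausdorff.

Section mesh.
Context {R : realType} {l : nat}.

(* (l-1)-dimensional measure. *)
Definition area (A : set 'rV[R]_l) : \bar R := hausdorff l.-1 A.

Definition outward_unit_normal (A s : set 'rV[R]_l) (n : 'rV[R]_l) :=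
  [/\ enorm n = 1,
      (forall x y, s x -> s y -> dot n (x - y) = 0) &
      area (s `\` [set x | exists2 e : R, 0 < e &
             forall t, 0 < t < e -> A (x - t *: n) /\ ~ A (x + t *: n)])
        = 0%E].

Section cells.
Variables (I : finType) (cell : I -> set 'rV[R]_l).

Definition interface (K L : I) : set 'rV[R]_l :=
  closure (cell K) `&` closure (cell L).

Definition neighbour (K L : I) : bool :=
  (K != L) && (0 < area (interface K L))%E.

(* All the edges of K: interfaces with the neighbours and exterior edges. *)
Definition edges (ext : I -> set (set 'rV[R]_l)) (K : I)
    : set (set 'rV[R]_l) :=
  [set interface K L | L in [set L | neighbour K L]] `|` ext K.

Definition mesh_size : R := sup (range (fun K => diam (cell K))).

(* ext K lists the (closed, flat) edges of K lying on the boundary of Omega;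
   nrm K s is the unit normal to the edge s, outward to K. *)
Record admissible_mesh (Omega : set 'rV[R]_l) (alpha : R)
    (ctr : I -> 'rV[R]_l) (ext : I -> set (set 'rV[R]_l))
    (nrm : I -> set 'rV[R]_l -> 'rV[R]_l) : Prop := AdmissibleMesh {
  mesh_polyhedral : forall K, polyhedral (cell K) ;
  mesh_connected : forall K, connected (cell K) ;
  mesh_sub : forall K, cell K `<=` Omega ;
  mesh_disjoint : forall K L, K != L -> cell K `&` cell L = set0 ;
  mesh_cover : closure Omega = \bigcup_K closure (cell K) ;
  mesh_interface_flat : forall K L, neighbour K L -> flat (interface K L) ;
  mesh_ext_finite : forall K, finite_set (ext K) ;
  mesh_ext : forall K s, ext K s ->
    [/\ closed s, s `<=` boundary Omega, flat s & (0 < area s)%E] ;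
  mesh_edges_overlap : forall K s s', edges ext K s -> edges ext K s' ->
    s <> s' -> area (s `&` s') = 0%E ;
  mesh_edges_boundary : forall K,
    boundary (cell K) = \bigcup_(s in edges ext K) s ;
  mesh_normal : forall K s, edges ext K s ->
    outward_unit_normal (cell K) s (nrm K s) ;
  mesh_volume : forall K, ((alpha * mesh_size ^+ l)%:E <= leb (cell K))%E ;
  mesh_perimeter : forall K,
    (area (boundary (cell K)) <= (alpha^-1 * mesh_size ^+ l.-1)%:E)%E ;
  mesh_center : forall K, cell K (ctr K) ;
  mesh_orthogonal : forall K L, neighbour K L ->
    forall y z, interface K L y -> interface K L z ->
      dot (ctr L - ctr K) (y - z) = 0
}.

Record numerical_flux (umax M : R) (f : R -> 'rV[R]_l)
    (ext : I -> set (set 'rV[R]_l)) (nrm : I -> set 'rV[R]_l -> 'rV[R]_l)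
    (F : I -> set 'rV[R]_l -> R -> R -> R) : Prop := NumericalFlux {
  flux_continuous : forall K s, edges ext K s ->
    continuous (fun ab : R * R => F K s ab.1 ab.2) ;
  flux_monotone : forall K s, edges ext K s ->
    (forall b, {homo (fun a => F K s a b) : a a' / a <= a'}) /\
    (forall a, {homo F K s a : b b' / b <= b' >-> b' <= b}) ;
  flux_conservative : forall K L, neighbour K L ->
    forall a b, F K (interface K L) a b = - F L (interface L K) b a ;
  flux_regular : forall K s, edges ext K s ->
    (forall b, b \in `[0, umax] ->
       (fine (area s) * M).-lipschitz_(`[0, umax]%classic)
         (fun a : R => F K s a b)) /\
    (forall a, a \in `[0, umax] ->
       (fine (area s) * M).-lipschitz_(`[0, umax]%classic)
         (fun b : R => F K s a b)) ;
  flux_consistent : forall K s, edges ext K s ->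
    {in `[0, umax], forall a,
      F K s a a = fine (area s) * dot (f a) (nrm K s)}
}.

Definition transmissibility (ctr : I -> 'rV[R]_l) (K L : I) : R :=
  fine (area (interface K L)) / enorm (ctr K - ctr L).

Definition cell_average (u0 : 'rV[R]_l -> R) (K : I) : R :=
  (fine (leb (cell K)))^-1 * \int[lebesgue]_(x in cell K) u0 x.

(* One implicit step of the scheme, from u to v, in the control volume K. *)
Definition scheme_step (ctr : I -> 'rV[R]_l)
    (F : I -> set 'rV[R]_l -> R -> R -> R) (phi : R -> R) (dt : R)
    (u v : I -> R) (K : I) :=
  fine (leb (cell K)) * ((v K - u K) / dt)
  + \sum_(L | neighbour K L) F K (interface K L) (v K) (v L)
  - \sum_(L | neighbour K L)
      transmissibility ctr K L * (phi (v L) - phi (v K)) = 0.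

End cells.
End mesh.

(* phi is given with its extension to R. *)
Record degenerate_diffusion {R : realType} (uc umax : R) (phi : R -> R) : Prop :=
  DegenerateDiffusion {
  diffusion_uc : uc \in `[0, umax] ;
  diffusion_continuous : continuous phi ;
  diffusion_nondecreasing : {homo phi : a b / a <= b} ;
  diffusion_lipschitz : [lipschitz phi a | a in `[0, umax]%classic] ;
  diffusion_zero : {in `[0, uc], forall a, phi a = 0} ;
  diffusion_increasing : {in `[uc, umax] &, {homo phi : a b / a < b}}
}.

Definition nondegenerate_couple {R : realType} {l : nat} (uc : R)
    (f : R -> 'rV[R]_l) :=
  forall xi : 'rV[R]_l, xi != 0 ->
  forall a b : R, 0 <= a -> a < b -> b <= uc ->
  ~ exists p q : R, {in `[a, b], forall t, dot xi (f t) = p * t + q}.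

(* Main.v *)
Require Import Defs.
From mathcomp Require Import all_boot all_order all_algebra.
From mathcomp Require Import all_classical all_reals all_analysis.
Import Order.TTheory GRing.Theory Num.Theory.
Import numFieldNormedType.Exports HBNNSimple.
Local Open Scope classical_set_scope.
Local Open Scope ring_scope.

(** One implicit step asks for a zero of a map v |-> (g K (v K) v)_K in which
g K w v, the residual of the scheme in K with w in place of v K, is continuous
in w and nonincreasing in every neighbouring value v L: the fluxes are monotone,
phi is nondecreasing and the transmissibilities are nonnegative. Moreover the
constants 0 and umax are a sub- and a supersolution. Indeed, since f vanishes
at 0 and at umax, so do the fluxes F(0,0) and F(umax,umax), and monotonicity
gives the sign of every flux F(0, v L) and F(umax, v L) with v L in [0, umax];
the time term has the right sign as soon as the previous values lie in
[0, umax].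

For such a system Perron's method replaces the usual topological degree or
Brouwer argument: the pointwise supremum of the subsolutions with values in
[0, umax] is a solution ([quasimonotone_system_solvable]). The solution stays in
[0, umax], so the step can be iterated ([scheme_step_solvable]); the iteration
starts because averages of u0 lie in [0, umax] ([cell_average_range]). *)

(** The point c is the supremum of the closed set {h <= 0}. The intermediate
value theorem on [c, b] yields a zero in that set beyond c, which can only be c
itself. *)
Lemma greatest_zero {R : realType} {a b : R} {h : R -> R} :
  a <= b -> continuous h -> h a <= 0 -> 0 <= h b ->
  exists c, [/\ a <= c <= b, h c = 0 &
    forall w, a <= w <= b -> h w <= 0 -> w <= c].
Proof.
move=> ab hc ha hb.
pose S := [set w | a <= w <= b /\ h w <= 0].
have Sa : S a by rewrite /S /= lexx ab.
have Sb : ubound S b by move=> w [/andP[]].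
have Sub : has_ubound S by exists b.
have closedS : closed S.
  have -> : S = `[a, b]%classic `&` h @^-1` [set x | x <= 0].
    by apply/seteqP; split => w; rewrite /S /= in_itv.
  apply: closedI; first exact: interval_closed.
  apply: preimage_closed; last exact: closed_le.
  by move=> x _; exact: hc.
have [/andP[ac cb] hc0] : S (sup S).
  by apply: closedS; apply: closure_sup => //; exists a.
have [w] : exists2 w, w \in `[sup S, b]%R & h w = 0.
  apply: IVT => //; first exact: continuous_subspaceT.
  by rewrite ge_min hc0 le_max hb orbT.
rewrite in_itv /= => /andP[cw wb] hw.
have Sw : S w by rewrite /S /= (le_trans ac cw) wb hw.
have wc : w = sup S by apply/eqP; rewrite eq_le cw andbT; exact: ub_le_sup.
exists (sup S); split; [by rewrite ac cb|by rewrite -wc|].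
by move=> t tab ht; exact: ub_le_sup.
Qed.

(** Perron's method. Let s be the pointwise supremum of the subsolutions, and
c K the greatest zero of g K _ s. A subsolution v lies below s, so v K satisfies
g K (v K) s <= 0 and v K <= c K; hence s <= c. Then g K (c K) c <= g K (c K) s
= 0, so c is itself a subsolution and c <= s. Thus c = s, and s is a zero. *)
Lemma quasimonotone_system_solvable {R : realType} {I : Type} {a b : R}
    (g : I -> R -> (I -> R) -> R) :
  a <= b ->
  (forall K v, continuous (fun w => g K w v)) ->
  (forall K w v v', (forall L, v L <= v' L) -> g K w v' <= g K w v) ->
  (forall K v, (forall L, a <= v L <= b) -> g K a v <= 0) ->
  (forall K v, (forall L, a <= v L <= b) -> 0 <= g K b v) ->
  exists v, (forall K, a <= v K <= b) /\ (forall K, g K (v K) v = 0).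
Proof.
move=> ab gc ganti ga gb.
pose S := [set v : I -> R |
  (forall K, a <= v K <= b) /\ (forall K, g K (v K) v <= 0)].
have Sa : S (fun=> a).
  have aab : forall L : I, a <= a <= b by rewrite lexx.
  by split => // K; exact: ga.
pose s K := sup [set v K | v in S].
have Sub K : ubound [set v K | v in S] b.
  by move=> _ [v [vab _] <-]; case/andP: (vab K).
have sS v K : S v -> v K <= s K.
  by move=> Sv; apply: ub_le_sup; [exists b|exists v].
have sle K c : (forall v, S v -> v K <= c) -> s K <= c.
  by move=> vc; apply: ge_sup => [|_ [v Sv <-]]; [exists a, (fun=> a)|exact: vc].
have sab K : a <= s K <= b.
  rewrite (sS _ K Sa) /=; apply: sle => v [vab _].
  by case/andP: (vab K).
have [c cP] := choice (fun K =>
  greatest_zero ab (gc K s) (ga K s sab) (gb K s sab)).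
have sc K : s K <= c K.
  have [_ _ cmax] := cP K.
  apply: sle => v Sv; apply: cmax; first exact: Sv.1.
  by apply: le_trans (Sv.2 K); apply: ganti => L; exact: sS.
have Sc : S c.
  split=> K; first by have [] := cP K.
  by have [_ <- _] := cP K; exact: ganti.
have cs : c = s by apply/funext => K; apply/eqP; rewrite eq_le sc sS.
by exists s; split => // K; have [_ + _] := cP K; rewrite cs.
Qed.

(** A simple function below the restriction of f to D is positive only on a
measurable subset A of D, so it is at most c times the indicator of A. Bounding
the measure of such subsets therefore bounds the integral; when mu comes from
an outer measure, the outer measure of D is such a bound by monotonicity. *)
Lemma integral_le_cst {d} {T : measurableType d} {R : realType}
    {mu : {measure set T -> \bar R}} {D : set T} {f : T -> R} {c : R}
    {m : \bar R} :
  0 <= c -> (forall x, D x -> 0 <= f x <= c) ->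
  (forall A, measurable A -> A `<=` D -> (mu A <= m)%E) ->
  (\int[mu]_(x in D) (f x)%:E <= c%:E * m)%E.
Proof.
move=> c0 f0c mD.
rewrite ge0_integralE; last by move=> x /f0c/andP[]; rewrite lee_fin.
apply: ge_ereal_sup => _ [h /= hf <-].
pose A := ~` (h @^-1` [set 0]).
have mA : measurable A by apply: measurableC; exact: measurable_funPTI.
have AD : A `<=` D.
  move=> x hx; apply: contrapT => Dx; apply: hx; apply/eqP.
  rewrite eq_le fun_ge0 andbT -lee_fin (le_trans (hf x))//.
  by rewrite patchN// notin_setE.
apply: (@le_trans _ _ (c%:E * mu A)%E); last first.
  by apply: lee_wpmul2l; [rewrite lee_fin|exact: mD].
rewrite -(sintegral_indic mu A).
rewrite -(sintegralrM mu c (indic_nnsfun R mA)).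
apply: (@le_sintegral _ _ _ mu h (scale_nnsfun (indic_nnsfun R mA) c0)) => x.
have -> : scale_nnsfun (indic_nnsfun R mA) c0 x = c * \1_A x by [].
rewrite indicE; have [Ax|/negP nAx] := boolP (x \in A).
  rewrite mulr1 -lee_fin (le_trans (hf x))//.
  have Dx := AD _ (set_mem Ax).
  by rewrite patchT ?inE// lee_fin; case/andP: (f0c _ Dx).
have /contrapT -> : ~ A x by move=> Ax; apply: nAx; rewrite inE.
by rewrite mulr0.
Qed.

(** If the cell has measure 0 or +oo, the factor (fine (leb (cell K)))^-1 is 0
by the conventions for fine and for the inverse, and so is the average; the
bound on the integral settles the remaining case. *)
Lemma cell_average_range (R : realType) (l : nat) (I : finType)
    (cell : I -> set 'rV[R]_l) (u0 : 'rV[R]_l -> R) (c : R) (K : I) :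
  0 <= c -> (forall x, cell K x -> 0 <= u0 x <= c) ->
  0 <= cell_average cell u0 K <= c.
Proof.
move=> c0 u0c; rewrite /cell_average /Rintegral.
set i := (\int[_]_(_ in _) _)%E.
have i0 : (0 <= i)%E.
  by apply: integral_ge0 => x /u0c/andP[]; rewrite lee_fin.
have ile : (i <= c%:E * leb (cell K))%E.
  apply: integral_le_cst => // A _ AK.
  by apply: le_cover_measure => //; exact: box_gauge_ge0.
have m0 : (0 <= leb (cell K))%E by exact: (outer_measure_ge0 (leb_outer R l)).
case: (leb (cell K)) m0 ile => [m| |] //=; last by rewrite invr0 mul0r lexx.
rewrite lee_fin -EFinM => m0 ile.
have ifin : i \is a fin_num.
  by rewrite ge0_fin_numE// (le_lt_trans ile) ?ltry.
have fi0 : 0 <= fine i by exact: fine_ge0.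
rewrite mulr_ge0 ?invr_ge0//=.
have := m0; rewrite le_eqVlt => /predU1P[<-|mpos]; first by rewrite invr0 mul0r.
by rewrite mulrC ler_pdivrMr// -lee_fin fineK.
Qed.

(** The range [0, umax] is preserved along with solvability, so that the step can
be repeated. *)
Lemma scheme_step_solvable {R : realType} {l : nat}
  {umax : R} (umax_gt0 : 0 < umax)
  {f : R -> 'rV[R]_l}
  {uc : R} {phi : R -> R} (phi_deg : degenerate_diffusion uc umax phi)
  {dt : R} (dt_gt0 : 0 < dt)
  {I : finType} {cell : I -> set 'rV[R]_l} (ctr : I -> 'rV[R]_l)
  {ext : I -> set (set 'rV[R]_l)} {nrm : I -> set 'rV[R]_l -> 'rV[R]_l}
  {M : R} {F : I -> set 'rV[R]_l -> R -> R -> R}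
  (flux : numerical_flux cell umax M f ext nrm F)
  (f_0 : f 0 = 0) (f_umax : f umax = 0) {u : I -> R} :
  (forall K, 0 <= u K <= umax) ->
  exists v, (forall K, 0 <= v K <= umax) /\
    (forall K, scheme_step cell ctr F phi dt u v K).
Proof.
move=> u_range; have umax_ge0 := ltW umax_gt0.
have edge K L : neighbour cell K L -> edges cell ext K (interface cell K L).
  by move=> KL; left; exists L.
have phi_mono := diffusion_nondecreasing phi_deg.
have m_ge0 K : 0 <= fine (leb (cell K)).
  by apply: fine_ge0; exact: (outer_measure_ge0 (leb_outer R l)).
have tau_ge0 K L : neighbour cell K L -> 0 <= transmissibility cell ctr K L.
  move=> /andP[_ area_gt0]; rewrite divr_ge0 ?sqrtr_ge0//.
  by rewrite fine_ge0// ltW.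
have dot0 n : dot 0 n = 0 :> R.
  by rewrite /dot big1// => i _; rewrite mxE mul0r.
have F_cst K L c : neighbour cell K L -> 0 <= c <= umax -> f c = 0 ->
    F K (interface cell K L) c c = 0.
  move=> /edge KL c_range fc.
  by rewrite (flux_consistent flux KL) ?in_itv// fc dot0 mulr0.
have F_cont K L b : neighbour cell K L ->
    continuous (fun w => F K (interface cell K L) w b).
  move=> /edge KL w; have FKL := flux_continuous flux KL.
  apply: (@continuous2_cvg _ _ _ _ _ _ id (fun=> b) _ w b (FKL (w, b))).
    exact: cvg_id.
  exact: cvg_cst.
pose g K w (v : I -> R) := fine (leb (cell K)) * ((w - u K) / dt)
  + \sum_(L | neighbour cell K L) F K (interface cell K L) w (v L)
  - \sum_(L | neighbour cell K L)
      transmissibility cell ctr K L * (phi (v L) - phi w).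
apply: (@quasimonotone_system_solvable _ _ 0 umax g) => //.
- move=> K v w; rewrite /g.
  apply: cvgB; first apply: cvgD.
  + apply: cvgM; first exact: cvg_cst.
    apply: cvgM; last exact: cvg_cst.
    by apply: cvgB; [exact: cvg_id|exact: cvg_cst].
  + apply: (cvg_big (op := +%R)); first exact: add_continuous.
    by move=> L KL; exact: F_cont.
  + apply: (cvg_big (op := +%R)); first exact: add_continuous.
    move=> L _; apply: cvgM; first exact: cvg_cst.
    apply: cvgB; first exact: cvg_cst.
    exact: (diffusion_continuous phi_deg).
- move=> K w v v' vv'; rewrite /g lerB//.
    rewrite lerD2l; apply: ler_sum => L /edge KL.
    by have [_] := flux_monotone flux KL; apply.
  apply: ler_sum => L KL; apply: ler_wpM2l; first exact: tau_ge0.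
  by rewrite lerD2r; exact: phi_mono.
- move=> K v v_range; rewrite /g subr_le0.
  apply: (@le_trans _ _ 0).
    rewrite -[leRHS]addr0 lerD//.
      rewrite mulr_ge0_le0// mulr_le0_ge0 ?invr_ge0 ?(ltW dt_gt0)// sub0r.
      by rewrite oppr_le0; case/andP: (u_range K).
    apply: sumr_le0 => L KL; rewrite -[leRHS](F_cst K L 0 KL) ?lexx//.
    have [_] := flux_monotone flux (edge _ _ KL); apply.
    by case/andP: (v_range L).
  apply: sumr_ge0 => L KL; rewrite mulr_ge0 ?tau_ge0// subr_ge0.
  by apply: phi_mono; case/andP: (v_range L).
- move=> K v v_range; rewrite /g subr_ge0.
  apply: (@le_trans _ _ 0).
    apply: sumr_le0 => L KL; rewrite mulr_ge0_le0 ?tau_ge0// subr_le0.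
    by apply: phi_mono; case/andP: (v_range L).
  rewrite addr_ge0//.
    rewrite mulr_ge0// divr_ge0 ?(ltW dt_gt0)// subr_ge0.
    by case/andP: (u_range K).
  apply: sumr_ge0 => L KL; rewrite -[leLHS](F_cst K L umax KL) ?lexx ?umax_ge0//.
  have [_] := flux_monotone flux (edge _ _ KL); apply.
  by case/andP: (v_range L).
Qed.

Theorem lemma4p8 (R : realType) (l : nat) (l_ge1 : (1 <= l)%N)
  (Omega : set 'rV[R]_l) (Omega_bounded : bounded_set Omega)
  (Omega_open : open Omega) (Omega_lip : lipschitz_boundary Omega)
  (umax : R) (umax_gt0 : 0 < umax)
  (f : R -> 'rV[R]_l) (f_cont : {within `[0, umax], continuous f})
  (uc : R) (phi : R -> R) (phi_deg : degenerate_diffusion uc umax phi)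
  (f_nondeg : nondegenerate_couple uc f)
  (u0 : 'rV[R]_l -> R) (u0_range : forall x, Omega x -> u0 x \in `[0, umax])
  (u0_meas : measurable_fun (Omega : set (lebType R l)) u0)
  (dt : R) (dt_gt0 : 0 < dt)
  (alpha : R) (alpha_gt0 : 0 < alpha)
  (I : finType) (cell : I -> set 'rV[R]_l) (ctr : I -> 'rV[R]_l)
  (ext : I -> set (set 'rV[R]_l)) (nrm : I -> set 'rV[R]_l -> 'rV[R]_l)
  (mesh : admissible_mesh cell Omega alpha ctr ext nrm)
  (M : R) (F : I -> set 'rV[R]_l -> R -> R -> R)
  (flux : numerical_flux cell umax M f ext nrm F)
  (f_0 : f 0 = 0) (f_umax : f umax = 0) :
  exists u : nat -> I -> R,
    (forall K, u 0%N K = cell_average cell u0 K) /\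
    (forall n K, scheme_step cell ctr F phi dt (u n) (u n.+1) K).
Proof.
pose in_range (u : I -> R) := forall K, 0 <= u K <= umax.
have average_range : in_range (cell_average cell u0).
  move=> K; apply: cell_average_range; first exact: ltW.
  by move=> x /(mesh_sub mesh)/u0_range; rewrite in_itv.
have step u : exists v, in_range u ->
    in_range v /\ forall K, scheme_step cell ctr F phi dt u v K.
  have [u_range|] := pselect (in_range u); last by exists u.
  by have [v vP] := scheme_step_solvable umax_gt0 phi_deg dt_gt0 ctr flux
    f_0 f_umax u_range; exists v.
have [next nextP] := choice step.
pose u n := iter n next (cell_average cell u0).
have u_range n : in_range (u n).
  by elim: n => [//|n /nextP[]].
by exists u; split => // n; have [] := nextP _ (u_range n).
Qed.
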